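(* Let $(W,S)$ be a Coxeter system, let $J\subseteq S$, and let $R=\mathbb{Z}[q^{1/2},q^{-1/2}]$, $t=q^{1/2}$. Let $M=M^J$ be the right Hecke algebra module with $R$-basis $\{m_x\}_{x\in W^J}$, let $M^0$ be its space of fixed points under the bar involution, and let ${}^{J}C'_y$ ($y\in W^J$) be the parabolic Kazhdan--Lusztig basis elements (all as defined in the context). Suppose $y\in W^J$ and that ${}^{J}C''_y\in M^0$ has the form $$ {}^{J}C''_y=\sum_{x\in W^J,\ x\le y} p^{J}_{x,y}(t^{-1})\,\bigl(m_x/t^{\ell(x)}\bigr),$$ where $p^{J}_{x,y}(t^{-1})$ is a polynomial in $t^{-1}$ (with integer coefficients) with zero constant term whenever $x<y$, and $p^{J}_{y,y}(t^{-1})=1$. Then ${}^{J}C''_y={}^{J}C'_y$.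
   Context: Let $(W,S)$ be a Coxeter system with length function $\ell$, identity $e$, and Bruhat--Chevalley order $\le$. Let $R=\mathbb{Z}[q^{1/2},q^{-1/2}]$ and $t=q^{1/2}$. The Hecke algebra $\mathcal{H}$ of $W$ is the free $R$-module with basis $T_x$ ($x\in W$), with identity $T_e$, and multiplication determined by $T_xT_y=T_{xy}$ if $\ell(xy)=\ell(x)+\ell(y)$ and $T_s^2=(q-1)T_s+qT_e$ for $s\in S$. Fix $J\subseteq S$ (possibly empty), let $W_J$ be the subgroup generated by $J$, and let $W^J$ be the set of distinguished (shortest) representatives of the right cosets $W_Jy$ in $W$. The right $\mathcal{H}$-module $M=M^J$ is free over $R$ with basis $\{m_x\}_{x\in W^J}$, where $m_x=m_eT_x$ for $x\in W^J$ and $m_eT_w=q^{\ell(w)}m_e$ for $w\in W_J$. Explicitly, for $x\in W^J$, $s\in S$: $m_xT_s=m_{xs}$ if $\ell(xs)>\ell(x)$ and $xs\in W^J$; $m_xT_s=q\,m_x$ if $\ell(xs)>\ell(x)$ and $xs\notin W^J$; $m_xT_s=q\,m_{xs}+(q-1)m_x$ if $\ell(xs)<\ell(x)$. The action of the commutative ring $R$ on $M$ is written on the left. Let $r\mapsto\overline{r}$ be the ring involution of $R$ sending $q^{1/2}$ to $q^{-1/2}$. The bar involution $m\mapsto\overline{m}$ on $M$ is the additive map satisfying $\overline{rm}=\overline{r}\,\overline{m}$, $\overline{m_e}=m_e$, and $\overline{mT_x}=\overline{m}\,\overline{T_x}$, where $\overline{T_x}=T_{x^{-1}}^{-1}$ ($r\in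 R$, $m\in M$, $x\in W$). Let $M^0=\{m\in M:\overline{m}=m\}$. By Deodhar, for each $y\in W^J$ there is a unique element ${}^{J}C'_y\in M^0$ of the form $${}^{J}C'_y=q^{-\ell(y)/2}\sum_{x\in W^J,\ x\le y}P^{J}_{x,y}(q)\,m_x$$ where the $P^{J}_{x,y}(q)$ are polynomials in $q$ with integer coefficients, of degree at most $(\ell(y)-\ell(x)-1)/2$ when $x<y$, and $P^{J}_{y,y}(q)=1$. Moreover, the elements ${}^{J}C'_y$ ($y\in W^J$) form a basis of $M^0$ over the ring $R^0=\{r\in R:\overline r=r\}$. *)

(* Defs.v *)
From HB Require Import structures.
From Stdlib Require Import Relation_Operators.
From mathcomp Require Import all_boot all_order all_algebra.
From mathcomp Require Import boolp classical_sets cardinality fsbigop.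

Set Implicit Arguments.
Unset Strict Implicit.
Unset Printing Implicit Defensive.

Import GRing.Theory.
Local Open Scope classical_set_scope.
Local Open Scope ring_scope.

(* Z[t, t^-1], with t standing for q^(1/2), as the subring of Z(t) of the
   fractions f such that f * t^n is a polynomial for some n. *)
Definition is_laurent (f : {fraction {poly int}}) : bool :=
  `[< exists n (p : {poly int}), f * tofrac 'X ^+ n = tofrac p >].

Lemma is_laurent_subring : subring_closed is_laurent.
Proof.
split.
- by apply/asboolP; exists 0, 1; rewrite expr0 mulr1 rmorph1.
- move=> f g /asboolP [m [a fa]] /asboolP [n [b gb]]; apply/asboolP.
  exists (m + n)%N, (a * 'X^n - b * 'X^m).
  by rewrite rmorphB !rmorphM !rmorphXn /= -fa -gb exprD mulrBl !mulrA;
     congr (_ - _); rewrite mulrAC.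
- move=> f g /asboolP [m [a fa]] /asboolP [n [b gb]]; apply/asboolP.
  by exists (m + n)%N, (a * b); rewrite rmorphM /= -fa -gb exprD mulrACA.
Qed.

HB.instance Definition _ :=
  GRing.isSubringClosed.Build {fraction {poly int}} is_laurent
    is_laurent_subring.

Record laurent := Laurent {
  laurent_val :> {fraction {poly int}};
  laurent_valP : laurent_val \in is_laurent }.

HB.instance Definition _ := [isSub for laurent_val].
HB.instance Definition _ := [Choice of laurent by <:].
HB.instance Definition _ := [SubChoice_isSubComNzRing of laurent by <:].

Definition laurent_unit : pred laurent :=
  fun r => `[< exists s, s * r = 1 >].

Definition laurent_inv (r : laurent) : laurent :=
  if pselect (exists s, s * r = 1) is left h then projT1 (cid h) else r.

Lemma laurent_mulVr : {in laurent_unit, left_inverse 1 laurent_inv *%R}.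
Proof.
move=> r /asboolP ur; rewrite /laurent_inv.
by case: pselect => // h; case: cid.
Qed.

Lemma laurent_unitP : forall r s : laurent, s * r = 1 -> laurent_unit r.
Proof. by move=> r s sr; apply/asboolP; exists s. Qed.

Lemma laurent_inv_out : {in [predC laurent_unit], laurent_inv =1 id}.
Proof.
move=> r /asboolP ur; rewrite /laurent_inv.
by case: pselect.
Qed.

HB.instance Definition _ := GRing.ComNzRing_hasMulInverse.Build laurent
  laurent_mulVr laurent_unitP laurent_inv_out.

Lemma tP : tofrac 'X \in is_laurent.
Proof. by apply/asboolP; exists 0, 'X; rewrite expr0 mulr1. Qed.

Lemma tVP : (tofrac 'X)^-1 \in is_laurent.
Proof.
apply/asboolP; exists 1, 1.
by rewrite expr1 rmorph1 mulVf // tofrac_eq0 polyX_eq0.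
Qed.

Definition t : laurent := Laurent tP.
Definition q : laurent := t ^+ 2.

Definition ev (r : laurent) (p : {poly int}) : laurent := (map_poly intr p).[r].

Lemma t_unit : t \is a GRing.unit.
Proof.
apply/unitrPr; exists (Laurent tVP); apply: val_inj.
by rewrite /= mulfV // tofrac_eq0 polyX_eq0.
Qed.

Lemma ev1 r : ev r 1 = 1.
Proof. by rewrite /ev rmorph1 hornerC. Qed.

Lemma evX r : ev r 'X = r.
Proof. by rewrite /ev map_polyX hornerX. Qed.

Lemma evB r a b : ev r (a - b) = ev r a - ev r b.
Proof. by rewrite /ev rmorphB hornerD hornerN. Qed.

Lemma evM r a b : ev r (a * b) = ev r a * ev r b.
Proof. by rewrite /ev rmorphM hornerM. Qed.

Lemma evXn r a n : ev r (a ^+ n) = ev r a ^+ n.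
Proof. by rewrite /ev rmorphXn horner_exp. Qed.

Lemma ev_t p : laurent_val (ev t p) = tofrac p.
Proof.
elim/poly_ind: p => [|p c IH]; first by rewrite /ev rmorph0 horner0 rmorph0.
rewrite /ev rmorphD rmorphM /= map_polyX map_polyC /= hornerMXaddC.
rewrite rmorphD rmorphM /= -IH; congr (_ + _).
have -> : c%:P = c%:~R :> {poly int} by rewrite -{1}[c]intz rmorph_int.
have val_int : laurent_val c%:~R = c%:~R.
  exact: (rmorph_int (val : {rmorphism laurent -> {fraction {poly int}}})).
by rewrite val_int rmorph_int.
Qed.

Lemma ev_t_inj : injective (ev t).
Proof.
by move=> a b /(congr1 laurent_val); rewrite !ev_t => /eqP;
   rewrite tofrac_eq => /eqP.
Qed.

Lemma laurentP (r : laurent) :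
  exists np : nat * {poly int}, r * t ^+ np.1 = ev t np.2.
Proof.
case: r => f fP; have /asboolP [n [p fp]] := fP.
by exists (n, p); apply: val_inj; rewrite /= ev_t -fp; congr (_ * _);
   exact: (rmorphXn (val : {rmorphism laurent -> {fraction {poly int}}})).
Qed.

(* The involution exchanging t and t^-1: if r = p(t) / t^n, then its image is
   p(t^-1) * t^n. *)
Definition rbar (r : laurent) : laurent :=
  let np := projT1 (cid (laurentP r)) in ev t^-1 np.2 * t ^+ np.1.

Lemma rbarE r n p : r * t ^+ n = ev t p -> rbar r = ev t^-1 p * t ^+ n.
Proof.
rewrite /rbar; case: cid => -[m a] /= ra rp.
have eq_pa : a * 'X^n = p * 'X^m.
  by apply: ev_t_inj; rewrite !evM !evXn !evX -ra -rp mulrAC.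
have := congr1 (ev t^-1) eq_pa; rewrite !evM !evXn !evX => eqV.
have tU k : t ^+ k * t^-1 ^+ k = 1.
  by rewrite -exprMn divrr ?t_unit // expr1n.
rewrite -[LHS]mulr1 -(tU n) -[RHS]mulr1 -(tU m).
rewrite [LHS](_ : _ = ev t^-1 a * t^-1 ^+ n * (t ^+ m * t ^+ n)).
  rewrite eqV -!mulrA; congr (_ * _).
  by rewrite mulrA [RHS]mulrC [t ^+ m * _]mulrC.
by rewrite -!mulrA; congr (_ * _); rewrite mulrA mulrC.
Qed.

Lemma rbar_zmod : zmod_morphism rbar.
Proof.
move=> r s; have [[m a] /= ra] := laurentP r; have [[n b] /= sb] := laurentP s.
rewrite (rbarE ra) (rbarE sb) (@rbarE _ (m + n) (a * 'X^n - b * 'X^m)); last first.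
  rewrite evB !evM !evXn !evX -ra -sb exprD mulrBl !mulrA.
  by congr (_ - _); rewrite mulrAC.
have tU k : t^-1 ^+ k * t ^+ k = 1.
  by rewrite -exprMn mulVr ?t_unit // expr1n.
rewrite evB !evM !evXn !evX exprD mulrBl; congr (_ - _).
  by rewrite [t ^+ m * _]mulrC -mulrA (mulrA (t^-1 ^+ n)) tU mul1r.
by rewrite -mulrA (mulrA (t^-1 ^+ m)) tU mul1r.
Qed.

Lemma rbar_monoid : monoid_morphism rbar.
Proof.
split; first by rewrite (@rbarE _ 0 1) ?ev1 ?mulr1.
move=> r s; have [[m a] /= ra] := laurentP r; have [[n b] /= sb] := laurentP s.
rewrite (rbarE ra) (rbarE sb) (@rbarE _ (m + n) (a * b)).
  by rewrite evM exprD mulrACA.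
by rewrite evM -ra -sb exprD mulrACA.
Qed.

HB.instance Definition _ :=
  GRing.isZmodMorphism.Build laurent laurent rbar rbar_zmod.
HB.instance Definition _ :=
  GRing.isMonoidMorphism.Build laurent laurent rbar rbar_monoid.

Lemma rbar_t : rbar t = t^-1.
Proof. by rewrite (@rbarE _ 0 'X) ?evX expr0 mulr1. Qed.

Section Coxeter.
Variable W : groupType.
Implicit Types (S J G : set W) (x y : W) (u v w : seq W).

Definition subgroup G : Prop :=
  [/\ G 1%g, forall x y, G x -> G y -> G (x * y)%g & forall x, G x -> G x^-1%g].

Definition generated S : set W := smallest subgroup S.

Definition word S w : Prop := forall s, s \in w -> S s.

Definition wprod w : W := foldr (fun s x => (s * x)%g) 1%g w.

(* The congruence on the words over [S] generated by (s r)^n ~ 1 for all s, r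
   in [S] and all n such that (s r)^n = 1 in the group, that is, for all the
   multiples n of the order of s r when this order is finite. The case s = r,
   n = 1 makes each generator its own inverse, so that words need no formal
   inverses. *)
Inductive word_equiv S : seq W -> seq W -> Prop :=
| word_equiv_rel s r n u v : S s -> S r -> ((s * r) ^+ n)%g = 1%g ->
    word_equiv S (u ++ flatten (nseq n [:: s; r]) ++ v) (u ++ v)
| word_equiv_refl u : word_equiv S u u
| word_equiv_sym u v : word_equiv S u v -> word_equiv S v u
| word_equiv_trans u v w :
    word_equiv S u v -> word_equiv S v w -> word_equiv S u w.

(* Bourbaki's definition: generators of order 2, and a presentation by the
   relations (s r)^m(s, r) = 1, where m(s, r) is the order of s r when it is
   finite. *)
Record coxeter_system S : Prop := CoxeterSystem {
  coxeter_involution : forall s, S s -> s <> 1%g /\ (s * s)%g = 1%g;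
  coxeter_generated : generated S = setT;
  coxeter_presentation : forall u v,
    word S u -> word S v -> wprod u = wprod v -> word_equiv S u v }.

Definition has_word_of_size S x (n : nat) : Prop :=
  exists w, [/\ word S w, wprod w = x & size w = n].

(* The default value 0 is only used when [x] is not a product of elements of
   [S], which does not happen in a Coxeter system. *)
Definition length S x : nat :=
  if pselect (exists n, `[< has_word_of_size S x n >]) is left h
  then ex_minn h else 0.

Definition reflection S x : Prop :=
  exists s g, S s /\ x = (g * s * g^-1)%g.

Definition bruhat_step S x y : Prop :=
  exists r, [/\ reflection S r, y = (x * r)%g & (length S x < length S y)%N].

Definition bruhat_le S x y : Prop := clos_refl_trans W (bruhat_step S) x y.

Definition bruhat_lt S x y : Prop := bruhat_le S x y /\ x <> y.

(* W^J: the elements of minimal length in their right coset W_J x. *)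
Definition min_reps S J : set W :=
  [set x | forall z, generated J z -> (length S x <= length S (z * x)%g)%N].

Definition bruhat_below S J y : set W :=
  [set x | min_reps S J x /\ bruhat_le S x y].

End Coxeter.

Definition is_basis (I : eqType) (V : lmodType laurent) (A : set I)
    (b : I -> V) : Prop :=
  (forall v, exists (s : seq I) (c : I -> laurent),
     (forall i, i \in s -> A i) /\ v = \sum_(i <- s) c i *: b i) /\
  (forall (s : seq I) (c : I -> laurent),
     uniq s -> (forall i, i \in s -> A i) ->
     \sum_(i <- s) c i *: b i = 0 -> forall i, i \in s -> c i = 0).

Record hecke_algebra (W : groupType) (S : set W) (H : unitAlgType laurent)
    (T : W -> H) : Prop := HeckeAlgebra {
  hecke_basis : is_basis setT T;
  hecke_one : T 1%g = 1;
  hecke_mul : forall x y, length S (x * y)%g = (length S x + length S y)%N ->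
    T x * T y = T (x * y)%g;
  hecke_quadratic : forall s, S s -> T s ^+ 2 = (q - 1) *: T s + q *: T 1%g }.

Record right_action (H : unitAlgType laurent) (M : lmodType laurent)
    (act : M -> H -> M) : Prop := RightAction {
  act_addl : forall m n h, act (m + n) h = act m h + act n h;
  act_addr : forall m h k, act m (h + k) = act m h + act m k;
  act_scalel : forall r m h, act (r *: m) h = r *: act m h;
  act_scaler : forall r m h, act m (r *: h) = r *: act m h;
  act_one : forall m, act m 1 = m;
  act_mul : forall m h k, act m (h * k) = act (act m h) k }.

(* Only the values of [m] on W^J are meaningful. *)
Record parabolic_module (W : groupType) (S J : set W)
    (H : unitAlgType laurent) (T : W -> H)
    (M : lmodType laurent) (act : M -> H -> M) (m : W -> M) : Prop :=
  ParabolicModule {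
  parabolic_action : right_action act;
  parabolic_basis : is_basis (min_reps S J) m;
  parabolic_rep : forall x, min_reps S J x -> m x = act (m 1%g) (T x);
  parabolic_sub : forall w, generated J w ->
    act (m 1%g) (T w) = q ^+ length S w *: m 1%g;
  parabolic_up : forall x s, min_reps S J x -> S s ->
    (length S x < length S (x * s)%g)%N -> min_reps S J (x * s)%g ->
    act (m x) (T s) = m (x * s)%g;
  parabolic_stay : forall x s, min_reps S J x -> S s ->
    (length S x < length S (x * s)%g)%N -> ~ min_reps S J (x * s)%g ->
    act (m x) (T s) = q *: m x;
  parabolic_down : forall x s, min_reps S J x -> S s ->
    (length S (x * s)%g < length S x)%N ->
    act (m x) (T s) = q *: m (x * s)%g + (q - 1) *: m x }.

(* The inverse is that of [H]: each [T x] is invertible since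
   T_s (T_s - (q - 1)) = q for [s] in [S]. *)
Record bar_involution (W : groupType) (H : unitAlgType laurent) (T : W -> H)
    (M : lmodType laurent) (act : M -> H -> M) (m : W -> M)
    (mbar : M -> M) : Prop := BarInvolution {
  bar_add : forall a b, mbar (a + b) = mbar a + mbar b;
  bar_scale : forall r a, mbar (r *: a) = rbar r *: mbar a;
  bar_one : mbar (m 1%g) = m 1%g;
  bar_act : forall a x, mbar (act a (T x)) = act (mbar a) (T x^-1%g)^-1 }.

Definition bar_fixed (M : lmodType laurent) (mbar : M -> M) : set M :=
  [set a | mbar a = a].

(* As [(size P).-1] is the degree of a nonzero [P], the bound says that the
   degree of [P x] is at most (length y - length x - 1) / 2. The sum is the one
   of finitely supported families, which loses nothing here since there are
   finitely many x <= y. *)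
Definition is_kazhdan_lusztig (W : groupType) (S J : set W)
    (M : lmodType laurent) (m : W -> M) (mbar : M -> M) (y : W) (C : M) : Prop :=
  bar_fixed mbar C /\
  exists P : W -> {poly int},
    [/\ C = t ^- length S y *:
              \sum_(x \in bruhat_below S J y) ev q (P x) *: m x,
        forall x, min_reps S J x -> bruhat_lt S x y ->
          ((size (P x)).-1.*2 < length S y - length S x)%N
      & P y = 1].

(* Main.v *)
Require Import Defs.
From Stdlib Require Import Relation_Operators Operators_Properties.
From mathcomp Require Import all_boot all_order all_algebra.
From mathcomp Require Import boolp classical_sets cardinality fsbigop.

Set Implicit Arguments.
Unset Strict Implicit.
Unset Printing Implicit Defensive.

Import GRing.Theory.
Local Open Scope classical_set_scope.
Local Open Scope ring_scope.

(** The difference of the two elements is bar-invariant, and its coefficients on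
    the normalized basis [t^-l(x) m_x] lie in [t^-1 Z[t^-1]]. Since the bar
    involution fixes [t^-l(x) m_x] up to combinations of strictly shorter basis
    elements, a nonzero coefficient at an [x] of maximal length would be fixed by
    [t <-> t^-1], which no nonzero element of [t^-1 Z[t^-1]] is.

    The sums over [x <= y] in the statement are junk (equal to 0) for infinite
    supports, so the finiteness of lower Bruhat intervals is needed. It follows
    from the strong exchange property: the parity of the number of occurrences
    of a reflection in the list attached to a word is invariant under the
    Coxeter relations. *)

(** * Parity of the reflections attached to a word *)

Section WordReflections.
Variable W : groupType.
Implicit Types (s r x : W) (u v w : seq W).
Local Open Scope group_scope.

(* For w = s_1 ... s_k, the reflections r_i such that w r_i is w with s_i
   deleted. *)
Fixpoint word_reflections w : seq W :=
  if w is s :: w' then s ^ wprod w' :: word_reflections w' else [::].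

(** The parity used in the classical proof of the exchange condition. For words over the generators
    of a Coxeter system it depends only on [wprod w]. *)
Definition odd_reflection w r : bool := odd (count_mem r (word_reflections w)).

Lemma wprod_cat u v : wprod (u ++ v) = wprod u * wprod v.
Proof. by elim: u => [|s u IH] /=; rewrite ?mul1g // IH mulgA. Qed.

Lemma wprod_rcons u s : wprod (rcons u s) = wprod u * s.
Proof. by rewrite -cats1 wprod_cat /= mulg1. Qed.

Lemma wprod_alternating s r n :
  wprod (flatten (nseq n [:: s; r])) = (s * r) ^+ n.
Proof. by elim: n => //= n ->; rewrite expgS mulgA. Qed.

Lemma word_reflections_cat u v :
  word_reflections (u ++ v) =
  [seq r ^ wprod v | r <- word_reflections u] ++ word_reflections v.
Proof. by elim: u => //= s u ->; rewrite wprod_cat conjgM. Qed.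

(** A cocycle rule: appending [v] conjugates the reflections of [u] by [wprod v]. *)
Lemma odd_reflection_cat u v r :
  odd_reflection (u ++ v) r =
  odd_reflection u (r ^ (wprod v)^-1) (+) odd_reflection v r.
Proof.
rewrite /odd_reflection word_reflections_cat count_cat oddD count_map.
congr (odd _ (+) _); apply: eq_count => x /=.
by apply/eqP/eqP => [<-|->]; rewrite ?conjgK ?conjgKV.
Qed.

Lemma odd_reflection_alternating s r n x :
  s * s = 1 -> r * r = 1 -> (s * r) ^+ n = 1 ->
  odd_reflection (flatten (nseq n [:: s; r])) x = false.
Proof.
move=> ss rr srn.
have sV : s^-1 = s by apply: (mulgI s); rewrite mulgV ss.
have rV : r^-1 = r by apply: (mulgI r); rewrite mulgV rr.
(* As in a dihedral group, [r] inverts [s * r]; this brings every reflection of the word to the form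
   r (s r)^i. *)
have srV k : ((s * r) ^+ k)^-1 * r = r * (s * r) ^+ k.
  elim: k => [|k IH]; first by rewrite !expg0 invg1 mul1g mulg1.
  rewrite [in LHS]expgS !invgM rV sV -mulgA -[r * s * r]mulgA [LHS]mulgA IH.
  by rewrite -mulgA -expgSr.
(* The reflections of the word are the r (s r)^i, for i < 2n, and they are
   n-periodic in i. *)
pose f i := x == r * (s * r) ^+ i.
have countE k : count_mem x (word_reflections (flatten (nseq k [:: s; r])))
    = (\sum_(i < k + k) f i)%N.
  elim: k => [|k IH]; first by rewrite big_ord0.
  rewrite addSn addnS !big_ord_recr /= IH !wprod_alternating.
  have -> : r ^ ((s * r) ^+ k) = r * (s * r) ^+ (k + k).
    by rewrite /conjg mulgA srV -mulgA -expgnDr.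
  have -> : s ^ (r * (s * r) ^+ k) = r * (s * r) ^+ (k + k).+1.
    rewrite /conjg invgM rV srV !mulgA -addSn expgnDr expgSr !mulgA.
    by [].
  by rewrite addnC [X in (X + _)%N]addnC /f !(eq_sym x).
rewrite /odd_reflection countE big_split_ord /= oddD.
rewrite [X in _ (+) odd X](eq_bigr (fun i : 'I_n => nat_of_bool (f i))) ?addbb //.
by move=> i _; rewrite /f expgnDr srn mul1g.
Qed.

(** * Words, lengths and strong exchange in a Coxeter system *)

Variable S : set W.
Hypothesis hS : coxeter_system S.

Lemma generator_mulgg s : S s -> s * s = 1.
Proof. by case/(coxeter_involution hS). Qed.

Lemma generator_invg s : S s -> s^-1 = s.
Proof. by move=> Ss; apply: (mulgI s); rewrite mulgV generator_mulgg. Qed.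

(** A relator has trivial product and even parities, so by the cocycle rule inserting it changes
    nothing. *)
Lemma word_equiv_odd_reflection u v : word_equiv S u v ->
  wprod u = wprod v /\ odd_reflection u =1 odd_reflection v.
Proof.
elim=> [s r n {}u {}v Ss Sr srn|w|{}u {}v _ [IH1 IH2]|{}u {}v w _ [IH1 IH2] _ [IH3 IH4]].
- split; first by rewrite !wprod_cat wprod_alternating srn mul1g.
  move=> x; rewrite !odd_reflection_cat wprod_cat wprod_alternating srn mul1g.
  by rewrite odd_reflection_alternating //; apply: generator_mulgg.
- by [].
- by split=> // x; rewrite IH2.
- by split=> [|x]; rewrite ?IH1 ?IH2.
Qed.

(** All relators have even size; this is the sign character at the level of words. *)
Lemma word_equiv_odd_size u v : word_equiv S u v -> odd (size u) = odd (size v).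
Proof.
elim=> // [s r n {}u {}v _ _ _|{}u {}v w _ -> _ ->] //.
rewrite !size_cat !oddD; congr (_ (+) _).
suff -> : odd (size (flatten (nseq n [:: s; r]))) = false by [].
by elim: n => //= n ->.
Qed.

Lemma word_cons s u : S s -> word S u -> word S (s :: u).
Proof. by move=> Ss Su r; rewrite inE => /predU1P[->|/Su]. Qed.

Lemma word_cat u v : word S u -> word S v -> word S (u ++ v).
Proof. by move=> Su Sv r; rewrite mem_cat => /orP[/Su|/Sv]. Qed.

Lemma word_rev u : word S u -> word S (rev u).
Proof. by move=> Su r; rewrite mem_rev => /Su. Qed.

Lemma wprod_rev u : word S u -> wprod (rev u) = (wprod u)^-1.
Proof.
elim: u => [|s u IH] Su; first by rewrite /= invg1.
have Ss : S s by apply: Su; rewrite inE eqxx.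
have Su' : word S u by move=> r ru; apply: Su; rewrite inE ru orbT.
by rewrite rev_cons wprod_rcons /= invgM IH // (generator_invg Ss).
Qed.

Lemma word_exists x : exists2 w, word S w & wprod w = x.
Proof.
have : setT x by [].
rewrite -(coxeter_generated hS) => genx.
apply: (genx [set z | exists2 w, word S w & wprod w = z]); split; last first.
  by move=> s Ss; exists [:: s]; rewrite /= ?mulg1 //; apply: word_cons.
split.
- by exists [::].
- move=> _ _ [u Su <-] [v Sv <-].
  by exists (u ++ v); [apply: word_cat | rewrite wprod_cat].
- move=> _ [u Su <-].
  by exists (rev u); [apply: word_rev | apply: wprod_rev].
Qed.

Lemma reduced_word x : exists w, [/\ word S w, wprod w = x & size w = length S x].
Proof.
rewrite /length; case: pselect => [h|[]].
  by case: ex_minnP => n /asboolP.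
by have [w Sw wx] := word_exists x; exists (size w); apply/asboolP; exists w.
Qed.

Lemma length_le_size w : word S w -> (length S (wprod w) <= size w)%N.
Proof.
move=> Sw; rewrite /length; case: pselect => // h.
by case: ex_minnP => n _; apply; apply/asboolP; exists w.
Qed.

Lemma length_eq0 x : length S x = 0%N -> x = 1.
Proof.
by have [w [_ <- <-]] := reduced_word x; case: w.
Qed.

Lemma length_mulgr x s : S s -> (length S (x * s) <= (length S x).+1)%N.
Proof.
move=> Ss; have [w [Sw <- <-]] := reduced_word x.
rewrite -wprod_rcons -(size_rcons _ s); apply: length_le_size.
by rewrite -cats1; apply: word_cat => //; apply: word_cons.
Qed.

Lemma odd_length w : word S w -> odd (length S (wprod w)) = odd (size w).
Proof.
move=> Sw; have [v [Sv vw <-]] := reduced_word (wprod w).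
by apply: word_equiv_odd_size; apply: (coxeter_presentation hS).
Qed.

Lemma length_mulgr_neq x s : S s -> length S (x * s) <> length S x.
Proof.
move=> Ss; have [w [Sw <- <-]] := reduced_word x => e.
have := congr1 odd e; rewrite -wprod_rcons odd_length ?size_rcons /=.
  by case: odd.
by rewrite -cats1; apply: word_cat => //; apply: word_cons.
Qed.

Lemma reduced_word_last x k : length S x = k.+1 ->
  exists z s, [/\ S s, x = z * s & length S z = k].
Proof.
move=> lx; have [w [Sw wx wl]] := reduced_word x; rewrite lx in wl.
case/lastP: w wx Sw wl => // w s wx Sw; rewrite size_rcons => -[wk].
have Ss : S s by apply: Sw; rewrite mem_rcons inE eqxx.
have Sw' : word S w by move=> r rw; apply: Sw; rewrite mem_rcons inE rw orbT.
exists (wprod w), s; split=> //; first by rewrite -wprod_rcons.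
apply/eqP; rewrite eqn_leq -{1}wk length_le_size //=.
by rewrite -ltnS -lx -wx wprod_rcons length_mulgr.
Qed.

(** For w = a s b and r = b^-1 s b one has w r = a b. *)
Lemma word_reflections_delete w r : word S w -> r \in word_reflections w ->
  exists v, [/\ word S v, wprod v = wprod w * r & (size v < size w)%N].
Proof.
elim: w => //= s w IH Ssw.
have Ss : S s by apply: Ssw; rewrite inE eqxx.
have Sw : word S w by move=> u uw; apply: Ssw; rewrite inE uw orbT.
rewrite inE => /predU1P[->|/(IH Sw)[v [Sv vw sv]]].
  exists w; split=> //.
  by rewrite /conjg !mulgA mulgK -mulgA mulgA generator_mulgg // mul1g.
exists (s :: v); split=> //=; first exact: word_cons.
by rewrite vw mulgA.
Qed.

Lemma odd_reflection_eq u v r : word S u -> word S v -> wprod u = wprod v ->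
  odd_reflection u r = odd_reflection v r.
Proof.
move=> Su Sv uv; have := coxeter_presentation hS Su Sv uv.
by move=> /word_equiv_odd_reflection[_ ->].
Qed.

Lemma odd_reflection_reflection w r : word S w -> reflection S r ->
  wprod w = r -> odd_reflection w r.
Proof.
move=> Sw [s [g [Ss rE]]] wr; have [u Su ug] := word_exists g.
have Ss1 : word S [:: s] by apply: word_cons.
have Sur := word_rev Su.
have uV : wprod (rev u) = g^-1 by rewrite wprod_rev // ug.
rewrite (@odd_reflection_eq _ (u ++ [:: s] ++ rev u)) //; last 2 first.
- by do 2![apply: word_cat => //].
- by rewrite !wprod_cat uV ug wr rE /= mulg1 mulgA.
(* Conjugating s by the word u adds each parity of u twice, once through
   u ++ rev u ~ [::]; only the central letter contributes. *)
have : odd_reflection (u ++ rev u) r = false.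
  rewrite (@odd_reflection_eq _ [::]) //; first exact: word_cat.
  by rewrite wprod_cat uV ug mulgV.
have rg : r ^ g = s by rewrite rE /conjg -!mulgA mulVg mulg1 mulKg.
rewrite !odd_reflection_cat !wprod_cat uV /= mulg1 invgM !invgK conjgM rg.
rewrite generator_invg // /conjg generator_mulgg // mulg1 generator_invg //.
by rewrite /odd_reflection /= conjg1 eqxx addbCA => ->.
Qed.

Lemma reflection_mulgg r : reflection S r -> r * r = 1.
Proof.
move=> [s [g [Ss ->]]].
by rewrite !mulgA mulgVK -(mulgA g) generator_mulgg // mulg1 mulgV.
Qed.

(** If [r] had even parity in [w], it would have odd parity in a reduced word of w r; deleting a
    letter there would give a word for w shorter than w r. *)
Lemma strong_exchange w r : word S w -> reflection S r ->
  (length S (wprod w * r) < length S (wprod w))%N -> r \in word_reflections w.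
Proof.
move=> Sw rr lt; suff: odd_reflection w r.
  by apply: contraTT => /count_memPn rw; rewrite /odd_reflection rw.
apply: contraLR lt => nodd; rewrite -leqNgt.
have [v [Sv vE sv]] := reduced_word (wprod w * r).
have [u Su ur] := word_exists r.
have r2 := reflection_mulgg rr.
have rV : r^-1 = r by apply: (mulgI r); rewrite mulgV r2.
(* Appending to [w] a word of [r] flips the parity at [r], since [r] is odd in its own words. *)
have oddv : odd_reflection v r.
  rewrite (@odd_reflection_eq _ (w ++ u)) //.
  - by rewrite odd_reflection_cat ur rV /conjg r2 mulg1 rV (negbTE nodd) odd_reflection_reflection.
  - exact: word_cat.
  - by rewrite wprod_cat ur vE.
have rv : r \in word_reflections v.
  by apply: contraLR oddv => /count_memPn rv; rewrite /odd_reflection rv.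
have [v' [Sv' v'E sv']] := word_reflections_delete Sv rv.
rewrite -sv; apply: leq_trans (ltnW sv').
by rewrite -(mulgK r (wprod w)) rV -vE -v'E length_le_size.
Qed.

(** By strong exchange, the last step of a chain up to [y] uses one of the finitely many reflections
    of a fixed reduced word of [y]; induct on length. *)
Lemma bruhat_le_finite y : finite_set [set x | bruhat_le S x y].
Proof.
have [n] := ubnP (length S y); elim: n y => // n IH y; rewrite ltnS => yn.
have [w [Sw wy sw]] := reduced_word y.
have fin : finite_set ([set y] `|` \bigcup_(r in [set r | r \in word_reflections w /\
    (length S (y * r) < length S y)%N]) [set x | bruhat_le S x (y * r)]).
  rewrite finite_setU; split; first exact: finite_set1.
  apply: bigcup_finite => [|r [_ ry]]; last exact/IH/(leq_trans ry).
  by apply: sub_finite_set (finite_seq (word_reflections w)) => r [].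
apply: sub_finite_set fin => x /= /clos_rt_rtn1_iff xy.
have [->|[z [[r [rr yE zy]] xz]]] :
    x = y \/ exists z, bruhat_step S z y /\ bruhat_le S x z.
- case: xy => [|z z' zz' xz]; first by left.
  by right; exists z; split=> //; apply/clos_rt_rtn1_iff.
- by left.
have yr : y * r = z by rewrite yE -mulgA reflection_mulgg // mulg1.
right; exists r => /=; rewrite yr //; split=> //.
by apply: strong_exchange => //; rewrite wy yr.
Qed.

End WordReflections.

(** * Laurent polynomials with only negative exponents *)

Section LaurentPolynomials.
Implicit Types (g h : laurent) (p : {poly int}).

(** The ideal t^-1 Z[t^-1] of Z[t^-1]. *)
Definition negative g : Prop := exists p, p`_0 = 0 /\ g = ev t^-1 p.

Lemma evE (r : laurent) n p : (size p <= n)%N ->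
  ev r p = \sum_(i < n) (p`_i)%:~R * r ^+ i.
Proof.
move=> pn; rewrite /ev (horner_coef_wide _ (leq_trans (size_poly _ _) pn)).
by apply: eq_bigr => i _; rewrite coef_map.
Qed.

Lemma ev_sum_monomials (r : laurent) n (c : 'I_n -> int) (e : 'I_n -> nat) :
  ev r (\sum_(i < n) c i *: 'X^(e i)) = \sum_(i < n) (c i)%:~R * r ^+ e i.
Proof.
rewrite /ev rmorph_sum horner_sum; apply: eq_bigr => i _ /=.
by rewrite map_polyZ /= map_polyXn hornerZ hornerXn.
Qed.

Lemma q_unit : q \is a GRing.unit. Proof. exact/unitrX/t_unit. Qed.

Lemma rbar_tV : rbar t^-1 = t.
Proof. by rewrite rmorphV ?t_unit //= rbar_t invrK. Qed.

Lemma rbar_ev (r : laurent) p : rbar (ev r p) = ev (rbar r) p.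
Proof.
rewrite !(evE _ (leqnn _)) rmorph_sum; apply: eq_bigr => i _.
by rewrite rmorphM rmorphXn /= rmorph_int.
Qed.

Lemma negativeB g h : negative g -> negative h -> negative (g - h).
Proof.
move=> [a [a0 ->]] [b [b0 ->]]; exists (a - b).
by rewrite coefB a0 b0 subr0 evB.
Qed.

Lemma mulVt_exp i n : (i <= n)%N -> t^-1 ^+ i * t ^+ n = t ^+ (n - i).
Proof.
move=> le_in; rewrite -{1}(subnK le_in) exprD mulrCA -exprMn mulVr ?t_unit //.
by rewrite expr1n mulr1.
Qed.

Lemma negative_rbar_eq0 g : negative g -> rbar g = g -> g = 0.
Proof.
move=> [p [p0 ->]]; rewrite rbar_ev rbar_tV => evp.
suff -> : p = 0 by rewrite /ev rmorph0 horner0.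
pose n := size p.
(* On the left only exponents >= n occur, on the right only exponents <= n. *)
have shift : p * 'X^n = \sum_(i < n) p`_i *: 'X^(n - i).
  apply: ev_t_inj; rewrite evM evXn evX evp (evE _ (leqnn n)) mulr_suml.
  rewrite ev_sum_monomials; apply: eq_bigr => i _.
  by rewrite -mulrA mulVt_exp ?(ltnW (ltn_ord i)).
(* The constant term vanishes by hypothesis; the others are read off in [shift] at exponents above
   n. *)
apply/polyP => i; rewrite coef0; case: i => // i.
have := congr1 (fun a : {poly int} => a`_(n + i.+1)) shift.
rewrite coefMXn ltnNge leq_addr /= addKn => ->.
rewrite coef_sum big1 // => j _; rewrite coefZ coefXn.
case: eqP => [e|_]; last by rewrite mulr0.
by have := leq_subr j n; rewrite -e addnS ltnNge leq_addr.
Qed.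

(** With d = l - k, the term q^i becomes t^-(d - 2i), and the degree bound is exactly 2i < d. *)
Lemma negative_ev_q p k l : ((size p).-1.*2 < l - k)%N ->
  negative (t ^- l * ev q p * t ^+ k).
Proof.
set d := (l - k)%N => pd; have kl : (k <= l)%N.
  by rewrite ltnW // -subn_gt0 (leq_ltn_trans _ pd).
exists (\sum_(i < size p) p`_i *: 'X^(d - i.*2)).
have lt_id (i : 'I_(size p)) : (i.*2 < d)%N.
  by apply: leq_ltn_trans pd; rewrite leq_double -ltnS (leq_trans (ltn_ord i)) ?leqSpred.
split.
  rewrite coef_sum big1 // => i _; rewrite coefZ coefXn eq_sym subn_eq0.
  by rewrite leqNgt lt_id mulr0.
rewrite ev_sum_monomials (evE _ (leqnn (size p))).
rewrite mulr_sumr mulr_suml; apply: eq_bigr => i _.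
rewrite mulrCA -!mulrA; congr (_ * _).
have U n : t ^+ n \is a GRing.unit by exact/unitrX/t_unit.
have -> : t ^+ l = t ^+ (d - i.*2) * (t ^+ i.*2 * t ^+ k).
  by rewrite -!exprD addnA subnK ?subnK // ltnW.
have -> : q ^+ i = t ^+ i.*2 by rewrite -mul2n exprM.
have UU : t ^+ i.*2 * t ^+ k \is a GRing.unit by rewrite unitrM !U.
by rewrite (invrM (U _) UU) mulrAC (mulVr UU) mul1r exprVn.
Qed.

End LaurentPolynomials.

(** * Spans and extraction of coefficients *)

Section Span.
Variables (I : choiceType) (V : lmodType laurent) (b : I -> V).
Implicit Types (A B : set I) (u v : V).

(** Built one term at a time, so that stability under the action is proved by induction, with no
    index lists. *)
Inductive span A : V -> Prop :=
| span0 : span A 0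
| spanZD c i v : A i -> span A v -> span A (c *: b i + v).

Lemma spanD A u v : span A u -> span A v -> span A (u + v).
Proof.
move=> + Av; elim=> [|c i {}u Ai _ IH]; first by rewrite add0r.
by rewrite -addrA; apply: spanZD.
Qed.

Lemma spanZ A c v : span A v -> span A (c *: v).
Proof.
elim=> [|d i {}v Ai _ IH]; first by rewrite scaler0; apply: span0.
by rewrite scalerDr scalerA; apply: spanZD.
Qed.

Lemma span_gen A i : A i -> span A (b i).
Proof.
by move=> Ai; rewrite -[b i]scale1r -[_ *: _]addr0; apply: spanZD => //; apply: span0.
Qed.

Lemma span_sum A (s : seq I) (F : I -> V) :
  (forall i, i \in s -> span A (F i)) -> span A (\sum_(i <- s) F i).
Proof.
move=> sF; rewrite big_seq; elim/big_rec: _ => [|i v si]; first exact: span0.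
exact/spanD/sF.
Qed.

Lemma spanS A B v : A `<=` B -> span A v -> span B v.
Proof.
move=> AB; elim=> [|c i {}v Ai _ IH]; first exact: span0.
by apply: spanZD => //; apply: AB.
Qed.

(** Repeated indices are merged because freeness in [is_basis] speaks of duplicate-free lists. *)
Lemma span_combination A v : span A v -> exists (s : seq I) (c : I -> laurent),
  [/\ uniq s, forall i, i \in s -> A i & v = \sum_(i <- s) c i *: b i].
Proof.
elim=> [|c i {}v Ai _ [s [d [us sA ->]]]].
  by exists [::], (fun=> 0); rewrite big_nil.
have [is_|nis] := boolP (i \in s).
  exists s, (fun j => if j == i then c + d i else d j); split=> //.
  rewrite !(bigD1_seq i is_ us) /= eqxx scalerDl addrA; congr (_ + _).
  by apply: eq_bigr => j /negbTE ->.
exists (i :: s), (fun j => if j == i then c else d j); split=> /=.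
- by rewrite nis.
- by move=> j; rewrite inE => /predU1P[->|/sA].
- rewrite big_cons eqxx; congr (_ + _); apply: eq_big_seq => j sj.
  by case: eqP sj nis => // -> ->.
Qed.

Lemma span_coef_eq0 A B a i v : is_basis B b -> A `<=` B -> B i -> ~ A i ->
  span A v -> a *: b i + v = 0 -> a = 0.
Proof.
move=> [_ free] AB Bi nAi /span_combination[s [c [us sA ->]]] e.
have nis : i \notin s by apply/negP => /sA.
pose d j := if j == i then a else c j.
have -> : a = d i by rewrite /d eqxx.
apply: (free (i :: s)); rewrite ?inE ?eqxx //= ?nis //.
  by move=> j; rewrite inE => /predU1P[->|/sA/AB].
rewrite big_cons -[RHS]e {1}/d eqxx; congr (_ + _); apply: eq_big_seq => j sj.
by rewrite /d; case: eqP sj nis => // -> ->.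
Qed.

End Span.

(** * Triangularity of the bar involution on the parabolic module *)

Section ParabolicBar.
Variables (W : groupType) (S J : set W) (H : unitAlgType laurent) (T : W -> H).
Variables (M : lmodType laurent) (act : M -> H -> M) (m : W -> M).
Variable mbar : M -> M.
Hypotheses (hS : coxeter_system S) (hH : hecke_algebra S T).
Hypotheses (hM : parabolic_module S J T act m).
Hypothesis hbar : bar_involution T act m mbar.

Definition shorter_reps k : set W :=
  [set z | min_reps S J z /\ (length S z < k)%N].

(** l(x) + 1 <= l(x s) <= l(z x s) <= l(z x) + 1. *)
Lemma min_reps_prefix x s : S s -> (length S x < length S (x * s)%g)%N ->
  min_reps S J (x * s)%g -> min_reps S J x.
Proof.
move=> Ss lt xs z Jz; rewrite -ltnS (leq_trans lt) //.
by apply: leq_trans (xs z Jz) _; rewrite mulgA length_mulgr.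
Qed.

Lemma hecke_inv s : S s -> (T s)^-1 = q^-1 *: (T s - (q - 1) *: 1).
Proof.
move=> Ss; have := hecke_quadratic hH Ss; rewrite expr2 (hecke_one hH) => TT.
have TV : (q^-1 *: (T s - (q - 1) *: 1)) * T s = 1.
  rewrite -scalerAl mulrBl -scalerAl mul1r TT addrAC subrr add0r scalerA.
  by rewrite mulVr ?q_unit // scale1r.
have VT : T s * (q^-1 *: (T s - (q - 1) *: 1)) = 1.
  rewrite -scalerAr mulrBr -scalerAr mulr1 TT addrAC subrr add0r scalerA.
  by rewrite mulVr ?q_unit // scale1r.
have U : T s \is a GRing.unit by apply/unitrP; exists (q^-1 *: (T s - (q - 1) *: 1)).
by apply: (mulrI U); rewrite mulrV // VT.
Qed.

Lemma act_inv a s : S s ->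
  act a (T s)^-1 = q^-1 *: (act a (T s) - (q - 1) *: a).
Proof.
move=> Ss; have hA := parabolic_action hM; rewrite hecke_inv //.
rewrite (act_scaler hA) (act_addr hA) -scaleNr (act_scaler hA) (act_one hA).
by rewrite scaleNr.
Qed.

(** The inverse of T_s combines T_s and 1, and each case of the action of T_s raises length by at
    most one. *)
Lemma span_act_inv k s v : S s -> span m (shorter_reps k) v ->
  span m (shorter_reps k.+1) (act v (T s)^-1).
Proof.
move=> Ss; have hA := parabolic_action hM.
elim=> [|c z {}v [Mz zk] _ IH].
  have -> : act 0 (T s)^-1 = 0.
    by have := act_scalel hA 0 0 (T s)^-1; rewrite !scale0r.
  exact: span0.
rewrite (act_addl hA) (act_scalel hA); apply/spanD => //; apply: spanZ.
rewrite act_inv //; apply: spanZ.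
have zk1 : shorter_reps k.+1 z by split=> //; apply: ltnW.
apply: spanD; last by rewrite -scaleNr; apply/spanZ/span_gen.
have [lt|gt|/esym e] := ltngtP (length S z) (length S (z * s)%g); last first.
- by case: (length_mulgr_neq hS Ss e).
- rewrite (parabolic_down hM) //; apply: spanD; apply/spanZ/span_gen => //.
  split; last exact: leqW (ltn_trans gt zk).
  (* Here z = (z s) s, so z s is the shortened representative. *)
  apply: (@min_reps_prefix _ s) => //; rewrite -mulgA (generator_mulgg hS) // mulg1 //.
have [Mzs|nMzs] := pselect (min_reps S J (z * s)%g).
  rewrite (parabolic_up hM) //; apply: span_gen; split=> //.
  by apply: leq_ltn_trans (length_mulgr hS _ Ss) _; rewrite ltnS.
by rewrite (parabolic_stay hM) //; apply/spanZ/span_gen.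
Qed.

(** Induction along x = z s: [mbar] sends m_x to mbar(m_z) T_s^-1, and m_z T_s^-1 = q^-1 (m_x - (q -
    1) m_z) contributes one factor q^-1. *)
Lemma bar_unitriangular x : min_reps S J x ->
  span m (shorter_reps (length S x)) (mbar (m x) - q ^- length S x *: m x).
Proof.
have hA := parabolic_action hM.
have [k] : exists k, k = length S x by exists (length S x).
elim: k x => [|k IH] x xk Mx.
  have -> : x = 1%g by apply: (length_eq0 hS).
  rewrite (bar_one hbar).
  have -> : length S 1%g = 0%N by rewrite xk (length_eq0 hS (esym xk)).
  by rewrite expr0 invr1 scale1r subrr; apply: span0.
have [z [s [Ss xzs zk]]] := reduced_word_last hS (esym xk).
have lt : (length S z < length S (z * s)%g)%N by rewrite -xzs -xk zk.
have Mz : min_reps S J z by apply: min_reps_prefix lt _; rewrite -?xzs.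
have xE : m x = act (m z) (T s) by rewrite xzs (parabolic_up hM) // -xzs.
have := IH z (esym zk) Mz; set v := mbar (m z) - _; rewrite zk => vk.
have mz : mbar (m z) = q ^- k *: m z + v by rewrite /v zk addrC subrK.
rewrite {1}xE (bar_act hbar) (generator_invg hS Ss) mz (act_addl hA).
rewrite (act_scalel hA) act_inv // -xE -xk.
have -> : q ^- k.+1 = q ^- k * q^-1 by rewrite exprS (invrM q_unit (unitrX k q_unit)).
(* The leading terms cancel; a multiple of m_z and v T_s^-1 remain. *)
rewrite scalerBr scalerBr !scalerA addrAC [X in X + _]addrAC subrr add0r.
apply: spanD; last exact: span_act_inv.
by rewrite -scaleNr; apply/spanZ/span_gen; split=> //; rewrite zk.
Qed.

Lemma negative_combination_eq0 (s : seq W) (g : W -> laurent) : uniq s ->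
  (forall x, x \in s -> min_reps S J x) -> (forall x, x \in s -> negative (g x)) ->
  let D := \sum_(x <- s) g x *: (t ^- length S x *: m x) in
  mbar D = D -> D = 0.
Proof.
move=> us sM sneg D.
pose s' := [seq x <- s | g x != 0].
have DE : D = \sum_(x <- s') g x *: (t ^- length S x *: m x).
  rewrite big_filter /D (bigID (fun x => g x != 0)) /= [X in _ + X]big1 ?addr0 //.
  by move=> x /negPn/eqP ->; rewrite scale0r.
move=> barD; rewrite DE; case s'E : s' => [|x0 s0]; first by rewrite big_nil.
have mem0 : x0 \in s' by rewrite s'E inE eqxx.
have [x xs' maxx] : exists2 x, x \in s' &
    forall z, z \in s' -> (length S z <= length S x)%N.
  have ex : exists n, has (fun x => length S x == n) s'.
    by exists (length S x0); apply/hasP; exists x0.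
  have bd n : has (fun x => length S x == n) s' -> (n <= \max_(x <- s') length S x)%N.
    by case/hasP => z zs /eqP <-; apply: leq_bigmax_seq.
  case: (ex_maxnP ex bd) => n /hasP[x xs /eqP <-] maxn; exists x => // z zs.
  by apply: maxn; apply/hasP; exists z.
have s's z : z \in s' -> z \in s by rewrite mem_filter => /andP[].
have us' : uniq s' by apply: filter_uniq.
(* Every representative but [x], not only the shorter ones: other indices may have the same maximal
   length. *)
pose A : set W := [set z | min_reps S J z /\ z <> x].
have bar0 : mbar 0 = 0.
  by have := bar_scale hbar 0 0; rewrite rmorph0 !scale0r.
have bar_sum (r : seq W) (F : W -> M) :
    mbar (\sum_(z <- r) F z) = \sum_(z <- r) mbar (F z).
  by apply: (big_morph mbar (bar_add hbar)).
have bar_term z : z \in s' ->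
    span m A (mbar (g z *: (t ^- length S z *: m z)) -
              rbar (g z) *: (t ^- length S z *: m z)).
  move=> zs; rewrite !(bar_scale hbar) -scalerBr; apply: spanZ.
  have := bar_unitriangular (sM _ (s's _ zs)).
  set v := _ - _ => vspan.
  have -> : mbar (m z) = q ^- length S z *: m z + v by rewrite addrC subrK.
  (* This is why m_z is normalized by t^-l(z): its leading coefficient becomes 1 under [mbar]. *)
  have tq : rbar (t ^- length S z) * q ^- length S z = t ^- length S z.
    have U n : t ^+ n \is a GRing.unit by exact/unitrX/t_unit.
    rewrite -exprVn rmorphXn /= rbar_tV.
    have -> : q ^+ length S z = t ^+ length S z * t ^+ length S z.
      by rewrite -exprD addnn -mul2n exprM.
    by rewrite (invrM (U _) (U _)) (mulVKr (U _)) exprVn.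
  rewrite scalerDr scalerA tq addrAC subrr add0r; apply: spanZ.
  apply: spanS vspan => u [Mu ulz]; split=> // ux.
  by have := maxx z zs; rewrite leqNgt -ux ulz.
(* All of mbar(D) - D except the multiple of m_x: the terms at other indices, then the triangular
   corrections. *)
have : span m A (\sum_(z <- s' | z != x)
    (rbar (g z) - g z) *: (t ^- length S z *: m z) +
    \sum_(z <- s') (mbar (g z *: (t ^- length S z *: m z)) -
              rbar (g z) *: (t ^- length S z *: m z))).
  apply: spanD; last exact: span_sum bar_term.
  rewrite -big_filter; apply: span_sum => z; rewrite mem_filter => /andP[zx zs].
  do 2!apply: spanZ; apply: span_gen; split; first exact/sM/s's.
  exact/eqP.
set v := (X in span m A X) => vspan.
have vE : ((rbar (g x) - g x) * t ^- length S x) *: m x + v = 0.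
  rewrite -scalerA /v addrA -(bigD1_seq x xs' us' (op := +%R)
    (F := fun z => (rbar (g z) - g z) *: (t ^- length S z *: m z))) /=.
  rewrite -big_split /= -[RHS](subrr D) -{1}barD DE bar_sum -sumrB.
  by apply: eq_bigr => z _; rewrite scalerBl addrC addrA subrK.
have U : t ^- length S x \is a GRing.unit by rewrite unitrV; exact/unitrX/t_unit.
have AM : A `<=` min_reps S J by move=> z [].
have nAx : ~ A x by case.
have /(canRL (mulrK U)) := span_coef_eq0 (parabolic_basis hM) AM
  (sM _ (s's _ xs')) nAx vspan vE.
rewrite mul0r => /eqP; rewrite subr_eq0 => /eqP barg.
have gx : g x = 0 by apply: negative_rbar_eq0 barg; apply/sneg/s's.
by move: xs'; rewrite mem_filter gx eqxx.
Qed.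

End ParabolicBar.

(** * Comparison of the two bar-invariant elements *)

Theorem mainTheorem1
  (W : groupType) (S : set W) (hS : coxeter_system S)
  (J : set W) (hJ : J `<=` S)
  (H : unitAlgType laurent) (T : W -> H) (hH : hecke_algebra S T)
  (M : lmodType laurent) (act : M -> H -> M) (m : W -> M)
  (hM : parabolic_module S J T act m)
  (mbar : M -> M) (hbar : bar_involution T act m mbar)
  (y : W) (hy : min_reps S J y)
  (C' : M) (hC' : is_kazhdan_lusztig S J m mbar y C')
  (C'' : M) (hC'' : bar_fixed mbar C'')
  (p : W -> {poly int})
  (hp0 : forall x, min_reps S J x -> bruhat_lt S x y -> (p x)`_0 = 0)
  (hpy : p y = 1)
  (hform : C'' = \sum_(x \in bruhat_below S J y)
                   ev t^-1 (p x) *: (t ^- length S x *: m x)) :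
  C'' = C'.
Proof.
case: hC' => barC' [P [C'E Pdeg Py]].
have fin : finite_set (bruhat_below S J y).
  by apply: sub_finite_set (bruhat_le_finite hS y) => x [].
pose s : seq W := finmap.enum_fset (fset_set (bruhat_below S J y)).
(* Coefficients of the difference on t^-l(x) m_x; the factor t^l(x) renormalizes those of [C']. *)
pose g x : laurent := ev t^-1 (p x) - t ^- length S y * ev q (P x) * t ^+ length S x.
have U n : t ^+ n \is a GRing.unit by exact/unitrX/t_unit.
have sA x : x \in s -> bruhat_below S J y x by rewrite in_fset_set // inE.
have sub_bar a b : mbar (a - b) = mbar a - mbar b.
  have N c : mbar (- c) = - mbar c.
    by rewrite -scaleN1r (bar_scale hbar) rmorphN1 scaleN1r.
  by rewrite (bar_add hbar) N.
have DE : C'' - C' = \sum_(x <- s) g x *: (t ^- length S x *: m x).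
  rewrite hform C'E !(fsbig_finite _ _ fin) scaler_sumr -sumrB; apply: eq_bigr => x _.
  by rewrite /g scalerBl !scalerA mulrK.
apply/eqP; rewrite -subr_eq0 DE; apply/eqP.
apply: (negative_combination_eq0 hS hH hM hbar); first exact: finmap.fset_uniq.
- by move=> x /sA[].
- move=> x /sA[Mx xy]; have [->|/eqP nxy] := eqVneq x y.
    (* At x = y both normalized coefficients are 1 and cancel. *)
    exists 0; rewrite coef0; split=> //.
    by rewrite /g hpy Py !ev1 mulr1 mulVr // subrr /ev rmorph0 horner0.
  have lt : bruhat_lt S x y by [].
  apply: negativeB; last exact/negative_ev_q/Pdeg.
  by exists (p x); split=> //; apply: hp0.
- by rewrite -DE sub_bar hC'' barC'.
Qed.
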